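(* Let $\mathcal{X}^1,\mathcal{X}^2$ be smooth complete Riemannian manifolds, let $p\ge 1$, and let $\pi=e^{-f}\in\mathcal{P}_p(\mathcal{X}^1\times\mathcal{X}^2)$. Let $(\mu_\star^1,\mu_\star^2)\in\mathcal{P}_p(\mathcal{X}^1)\times\mathcal{P}_p(\mathcal{X}^2)$ be a pair of fixed points, $\mu_\star^1=\mu_\star^1[\mu_\star^2]$ and $\mu_\star^2=\mu_\star^2[\mu_\star^1]$. Assume: (i) the optimality map $\mu_\star^1[\cdot]:\mathcal{P}(\mathcal{X}^2)\to\mathcal{P}(\mathcal{X}^1)$ is Fisher-smooth with constant $L_{12}$ at $B_{\varepsilon_2}(\mu_\star^2)$, and the optimality map $\mu_\star^2[\cdot]:\mathcal{P}(\mathcal{X}^1)\to\mathcal{P}(\mathcal{X}^2)$ is Fisher-smooth with constant $L_{21}$ at $B_{\varepsilon_1}(\mu_\star^1)$; (ii) $\mu_\star^1$ and $\mu_\star^2$ satisfy transportation-information inequalities with constants $\lambda_1$ and $\lambda_2$, respectively. Suppose $L_{12}L_{21}<\lambda_1\lambda_2$ and let $k\ge1$. Let $(\mu_k^1,\mu_k^2)_k$ be the iterates of the two-block sequential CAVI algorithm. Then, whenever $\mu_k^1\in B_{\varepsilon_1}(\mu_\star^1)$ and $\mu_k^2\in B_{\varepsilon_2}(\mu_\star^2)$, $$\mathbb{W}_p(\mu_{k+1}^1,\mu_\star^1)\le\frac{L_{12}L_{21}}{\lambda_1\lambda_2}\,\mathbb{W}_p(\mu_k^1,\mu_\star^1)\quad\text{and}\quad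 \mathbb{W}_p(\mu_{k+1}^2,\mu_\star^2)\le\frac{L_{12}L_{21}}{\lambda_1\lambda_2}\,\mathbb{W}_p(\mu_k^2,\mu_\star^2).$$ In particular, $(\mu_{k+1}^1,\mu_{k+1}^2)\in B_{\varepsilon_1}(\mu_\star^1)\times B_{\varepsilon_2}(\mu_\star^2)$, and the two-block sequential CAVI algorithm converges exponentially fast to $(\mu_\star^1,\mu_\star^2)$ in Wasserstein-$p$ distance with rate $\frac{L_{12}L_{21}}{\lambda_1\lambda_2}$ (that is, the two one-step bounds hold at every subsequent iteration).
   Context: For a smooth complete Riemannian manifold $\mathcal{X}$ with geodesic distance $\mathsf{d}$ and volume measure $dx$, $\mathcal{P}(\mathcal{X})$ is the set of probability measures and $\mathcal{P}_p(\mathcal{X})$ the set of probability measures absolutely continuous with respect to $dx$ with finite $p$-th moment. Measures are identified with their densities; $\pi=e^{-f}$ means that $\pi$ has density $e^{-f}$. Wasserstein distance: $\mathbb{W}_p(\varrho_1,\varrho_2)=\inf_{\gamma}\left(\int \mathsf{d}(x_1,x_2)^p\,\gamma(dx_1,dx_2)\right)^{1/p}$, infimum over couplings $\gamma$ of $\varrho_1,\varrho_2$. Ball: $B_\varepsilon(\varrho)=\{\mu\in\mathcal{P}_p(\mathcal{X}):\mathbb{W}_p(\mu,\varrho)<\varepsilon\}$, $\varepsilon\in(0,\infty]$. Relative Fisher information: $\mathcal{I}(\varrho_1\|\varrho_2)=\int|\nabla\log\frac{d\varrho_1}{d\varrho_2}|^2\,d\varrho_1$ if $\varrho_1\ll\varrho_2$,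 and $+\infty$ otherwise ($\nabla$, $|\cdot|$ the Riemannian gradient and norm). Fisher-smoothness: $\gamma_\star[\cdot]:\mathcal{P}(\mathcal{X})\to\mathcal{P}(\mathcal{X}')$ is Fisher-smooth with constant $L\ge0$ at $B_\varepsilon(\nu)$ if $\mathcal{I}(\gamma_\star[\mu]\|\gamma_\star[\nu])\le L^2\,\mathbb{W}_p^2(\mu,\nu)$ for all $\mu\in B_\varepsilon(\nu)$. Transportation-information inequality: $\gamma\in\mathcal{P}_p(\mathcal{X})$ satisfies it with constant $\lambda>0$ if $\lambda^2\,\mathbb{W}_p^2(\mu,\gamma)\le\mathcal{I}(\mu\|\gamma)$ for all $\mu\in\mathcal{P}(\mathcal{X})$ with $\mu\ll\gamma$. Optimality maps: $\mu_\star^1[\nu^2](x_1)\propto\exp(-\mathbb{E}_{X_2\sim\nu^2}f(x_1,X_2))$ and $\mu_\star^2[\nu^1](x_2)\propto\exp(-\mathbb{E}_{X_1\sim\nu^1}f(X_1,x_2))$ (densities with respect to the volume measures). They are assumed to be well defined at the measures to which they are applied. Two-block sequential CAVI: from an initial $\mu_0^2$, for $k\ge0$, $\mu_{k+1}^1=\mu_\star^1[\mu_k^2]$ (the minimiser of $\mu^1\mapsto\mathrm{KL}(\mu^1\otimes\mu_k^2\|\pi)$) and $\mu_{k+1}^2=\mu_\star^2[\mu_{k+1}^1]$ (the minimiser of $\mu^2\mapsto\mathrm{KL}(\mu_{k+1}^1\otimes\mu^2\|\pi)$). *)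

(* Defs.v *)
From HB Require Import structures.
From mathcomp Require Import all_boot all_order all_algebra.
From mathcomp Require Import all_classical all_reals all_analysis.
From mathcomp Require Import measurable_realfun.

Set Implicit Arguments.
Unset Strict Implicit.
Unset Printing Implicit Defensive.

Import Order.TTheory GRing.Theory Num.Theory.
Import numFieldNormedType.Exports.

Local Open Scope classical_set_scope.
Local Open Scope ring_scope.
Local Open Scope ereal_scope.

(** * Lebesgue measure on R^n *)

Section power_measure.
Context d (T : measurableType d) (R : realType).
Variable l : {sigma_finite_measure set T -> \bar R}.

Definition tuple_cons n (z : T * n.-tuple T) : n.+1.-tuple T :=
  [the n.+1.-tuple T of z.1 :: z.2].

Lemma measurable_tuple_cons n : measurable_fun setT (@tuple_cons n).
Proof. exact: measurable_cons. Qed.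

Section succ.
Variables (n : nat) (m : {sigma_finite_measure set (n.-tuple T) -> \bar R}).

Definition cons_measure (A : set (n.+1.-tuple T)) : \bar R :=
  (l \x m) (@tuple_cons n @^-1` A).

Let preim_measurable A : measurable A -> measurable (@tuple_cons n @^-1` A).
Proof.
by move=> mA; rewrite -[X in measurable X]setTI; exact: measurable_tuple_cons.
Qed.

Let cons_measure0 : cons_measure set0 = 0.
Proof. by rewrite /cons_measure preimage_set0 measure0. Qed.

Let cons_measure_ge0 A : 0 <= cons_measure A.
Proof. exact: measure_ge0. Qed.

Let cons_measure_sigma_additive : semi_sigma_additive cons_measure.
Proof.
move=> F mF tF mUF; rewrite /cons_measure preimage_bigcup.
apply: measure_semi_sigma_additive.
- by move=> i; exact: preim_measurable.
- apply/trivIsetP => /= i j _ _ ij; rewrite -preimage_setI.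
  by move/trivIsetP : tF => /(_ _ _ _ _ ij) ->//; rewrite preimage_set0.
- by rewrite -preimage_bigcup; exact: preim_measurable.
Qed.

HB.instance Definition _ := isMeasure.Build _ _ _ cons_measure
  cons_measure0 cons_measure_ge0 cons_measure_sigma_additive.

Let cons_measure_sigma_finite : sigma_finite setT cons_measure.
Proof.
have /sigma_finiteP[F [TF ndF Foo]] := sigma_finiteT l.
have /sigma_finiteP[G [TG ndG Goo]] := sigma_finiteT m.
pose u (t : n.+1.-tuple T) : T * n.-tuple T := (thead t, [tuple of behead t]).
have mu : measurable_fun setT u.
  apply: measurable_fun_pair; first exact: measurable_tnth.
  exact: measurable_behead.
have uK : cancel (@tuple_cons n) u.
  by move=> [x t]; rewrite /u /tuple_cons/=; congr pair; exact/val_inj.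
exists (fun k => u @^-1` (F k `*` G k)).
  rewrite -preimage_bigcup (_ : \bigcup_k _ = setT) ?preimage_setT//.
  rewrite -setXTT TF TG predeqE => -[x y]; split.
    by move=> [k _ [/= Fx Gy]]; split; exists k.
  move=> [/= [i _ Fix] [j _ Gjy]]; exists (maxn i j) => //; split.
  - by move: x Fix; exact/subsetPset/ndF/leq_maxl.
  - by move: y Gjy; exact/subsetPset/ndG/leq_maxr.
move=> k; have [? ?] := Foo k; have [? ?] := Goo k; split.
  by rewrite -[X in measurable X]setTI; apply: mu => //; exact: measurableX.
rewrite /cons_measure -comp_preimage (_ : u \o _ = id) ?preimage_id; last first.
  by apply/funext => x /=; rewrite uK.
by rewrite product_measure1E// lte_mul_pinfty// ge0_fin_numE.
Qed.

HB.instance Definition _ :=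
  Measure_isSigmaFinite.Build _ _ _ cons_measure cons_measure_sigma_finite.

End succ.

Fixpoint power_measure n : {sigma_finite_measure set (n.-tuple T) -> \bar R} :=
  if n is n'.+1 then cons_measure (power_measure n') else dirac [tuple].

End power_measure.

Section euclidean.
Context {R : realType} {n : nat}.

Definition lebesgue_tuple :
    {sigma_finite_measure set (n.-tuple (measurableTypeR R)) -> \bar R} :=
  power_measure (@lebesgue_measure R) n.

Definition rV_of_tuple (t : n.-tuple (measurableTypeR R)) : 'rV[R]_n :=
  (\row_i (tnth t i : R))%R.

(** The row vectors carry the topology and the tuples the sigma-algebra, so
    integrals over R^n are computed through [rV_of_tuple]. *)
Definition integral_rV (D : set 'rV[R]_n) (F : 'rV[R]_n -> \bar R) : \bar R :=
  \int[lebesgue_tuple]_(t in rV_of_tuple @^-1` D) F (rV_of_tuple t).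

Definition integrable_rV (D : set 'rV[R]_n) (F : 'rV[R]_n -> R) : Prop :=
  lebesgue_tuple.-integrable (rV_of_tuple @^-1` D)
    (fun t => (F (rV_of_tuple t))%:E).

Definition locally_integrable_rV (O : set 'rV[R]_n) (F : 'rV[R]_n -> R) : Prop :=
  forall K, compact K -> K `<=` O -> integrable_rV K F.

Fixpoint Ck_on (k : nat) (O : set 'rV[R]_n) (F : 'rV[R]_n -> R) : Prop :=
  (forall y, O y -> {for y, continuous F}) /\
  if k is k'.+1 then
    forall i : 'I_n,
      (forall y, O y -> derivable F y ('e_i)%R) /\ Ck_on k' O ('D_('e_i)%R F)
  else True.

Definition smooth_on (O : set 'rV[R]_n) (F : 'rV[R]_n -> R) : Prop :=
  forall k, Ck_on k O F.

Definition test_function (O : set 'rV[R]_n) (psi : 'rV[R]_n -> R) : Prop :=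
  smooth_on setT psi /\
  exists K, [/\ compact K, K `<=` O & forall y, ~ K y -> psi y = 0%R].

(** [v] is the weak (distributional) [i]-th partial derivative of [u] on [O]. *)
Definition weak_partial (O : set 'rV[R]_n) (i : 'I_n) (u v : 'rV[R]_n -> R) :
    Prop :=
  [/\ locally_integrable_rV O u, locally_integrable_rV O v &
   forall psi, test_function O psi ->
     integral_rV O (fun y => (u y * 'D_('e_i)%R psi y)%R%:E) =
     - integral_rV O (fun y => (v y * psi y)%R%:E)].

End euclidean.

(** * Complete Riemannian manifolds *)

#[short(type="completeMetricMeasurableType")]
HB.structure Definition CompleteMetricMeasurable d (R : realType) :=
  {X of Measurable d X & Metric R X & Complete X}.

Section riemannian.
Context {d : measure_display} {R : realType}.
Implicit Type n : nat.

Record chart n (X : completeMetricMeasurableType d R) := Chart {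
  chart_dom : set X ;
  chart_map : X -> 'rV[R]_n ;
  chart_inv : 'rV[R]_n -> X }.

Definition chart_image n X (c : chart n X) : set 'rV[R]_n :=
  chart_map c @` chart_dom c.

Definition is_chart n X (c : chart n X) : Prop :=
  [/\ open (chart_dom c), open (chart_image c),
      forall x, chart_dom c x -> {for x, continuous (chart_map c)},
      forall y, chart_image c y -> {for y, continuous (chart_inv c)} &
      forall x, chart_dom c x -> chart_inv c (chart_map c x) = x].

Definition transition n X (c c' : chart n X) : 'rV[R]_n -> 'rV[R]_n :=
  chart_map c' \o chart_inv c.

(** A tangent vector at [x] has components [v] in the chart [c] and
    [v *m transition_jacobian c c' x] in the chart [c']. *)
Definition transition_jacobian n X (c c' : chart n X) (x : X) : 'M[R]_n :=
  'J (transition c c') (chart_map c x).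

(** [metric_mx c x] is the Gram matrix of the Riemannian metric at [x] in the
    coordinate frame of [c]; it is only meaningful for [c] in the atlas and [x]
    in the domain of [c]. *)
Record metric_data n (X : completeMetricMeasurableType d R) := MetricData {
  atlas : set (chart n X) ;
  chart_at : X -> chart n X ;
  metric_mx : chart n X -> X -> 'M[R]_n }.

Section metric_data_theory.
Context {n : nat} {X : completeMetricMeasurableType d R}.
Variable g : metric_data n X.

Definition sqnorm (c : chart n X) (x : X) (v : 'rV[R]_n) : R :=
  ((v *m metric_mx g c x *m v^T) 0 0)%R.

Definition is_smooth_atlas : Prop :=
  [/\ forall c, atlas g c -> is_chart c,
      forall x, atlas g (chart_at g x) /\ chart_dom (chart_at g x) x &
      forall c c', atlas g c -> atlas g c' -> forall j : 'I_n,
        smooth_on (chart_map c @` (chart_dom c `&` chart_dom c'))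
          (fun y => transition c c' y ord0 j)].

Definition is_riemannian_metric : Prop :=
  [/\ forall c x, atlas g c -> chart_dom c x ->
        (metric_mx g c x)^T%R = metric_mx g c x /\
        forall v, v != 0%R -> (0 < sqnorm c x v)%R,
      forall c (i j : 'I_n), atlas g c ->
        smooth_on (chart_image c) (fun y => metric_mx g c (chart_inv c y) i j) &
      forall c c' x, atlas g c -> atlas g c' ->
        chart_dom c x -> chart_dom c' x ->
        let J := transition_jacobian c c' x in
        metric_mx g c x = (J *m metric_mx g c' x *m J^T)%R].

Definition C1_curve (gam : R -> X) : Prop :=
  continuous gam /\
  forall c t, atlas g c -> chart_dom c (gam t) ->
    (\forall s \near t, derivable (chart_map c \o gam) s 1%R) /\
    {for t, continuous (derive1 (chart_map c \o gam))}.

Definition speed (gam : R -> X) (t : R) : R :=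
  let c := chart_at g (gam t) in
  Num.sqrt (sqnorm c (gam t) (derive1 (chart_map c \o gam) t)).

Definition curve_length (gam : R -> X) : \bar R :=
  \int[lebesgue_measure]_(t in `[0%R, 1%R]) (speed gam t)%:E.

Definition geodesic_dist (x y : X) : \bar R :=
  ereal_inf [set curve_length gam | gam in
    [set gam | [/\ C1_curve gam, gam 0%R = x & gam 1%R = y]]].

Definition is_riemannian_volume (vol : set X -> \bar R) : Prop :=
  forall c A, atlas g c -> measurable A -> A `<=` chart_dom c ->
    vol A = integral_rV (chart_map c @` A)
      (fun y => (Num.sqrt (\det (metric_mx g c (chart_inv c y))))%:E).

Definition is_vector_field (V : chart n X -> X -> 'rV[R]_n) : Prop :=
  forall c c' x, atlas g c -> atlas g c' -> chart_dom c x -> chart_dom c' x ->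
    V c' x = (V c x *m transition_jacobian c c' x)%R.

End metric_data_theory.

(** The carrier is the metric space of the manifold: its distance is the
    geodesic one (so the manifold is connected), it is complete, and its
    sigma-algebra is the Borel one. *)
Record riemannian n (X : completeMetricMeasurableType d R) := Riemannian {
  metric_of :> metric_data n X ;
  volume : {sigma_finite_measure set X -> \bar R} ;
  _ : @second_countable X ;
  _ : @measurable d X = <<s @open X >> ;
  _ : is_smooth_atlas metric_of ;
  _ : is_riemannian_metric metric_of ;
  _ : forall x y, (mdist x y)%:E = geodesic_dist metric_of x y ;
  _ : is_riemannian_volume metric_of volume }.

End riemannian.

(** * Densities, Wasserstein distance, Fisher information *)

Section density.
Context d (T : measurableType d) (R : realType).

Definition is_density (m nu : set T -> \bar R) (h : T -> \bar R) : Prop :=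
  [/\ measurable_fun [set: T] h, forall x, 0 <= h x &
      forall A, measurable A -> nu A = \int[m]_(x in A) h x].

End density.

Section wasserstein.
Context {d : measure_display} {R : realType}.
Context {X : completeMetricMeasurableType d R}.

Definition coupling (mu nu : probability X R) :
    set (probability (X * X)%type R) :=
  [set gam | forall A, measurable A ->
     gam (A `*` [set: X]) = mu A /\ gam ([set: X] `*` A) = nu A].

Definition wasserstein (p : R) (mu nu : probability X R) : \bar R :=
  (ereal_inf [set \int[gam]_z ((mdist z.1 z.2) `^ p)%R%:E
             | gam in coupling mu nu]) `^ p^-1.

End wasserstein.

Section information.
Context {d : measure_display} {R : realType} {n : nat}.
Context {X : completeMetricMeasurableType d R}.
Variable g : riemannian n X.

(** Finiteness of the moment does not depend on the base point [x0]. *)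
Definition in_Pp (p : R) (mu : probability X R) : Prop :=
  mu `<< volume g /\
  exists x0 : X, \int[mu]_x ((mdist x0 x) `^ p)%R%:E < +oo.

Definition wball (p : R) (eps : \bar R) (rho : probability X R) :
    set (probability X R) :=
  [set mu | in_Pp p mu /\ wasserstein p mu rho < eps].

Definition clamp (k : nat) (e : \bar R) : R :=
  fine (maxe (- (k%:R)%:E) (mine (k%:R)%:E e)).

(** [V] is the weak Riemannian gradient of [log h].  As [log h] need not be
    locally integrable (it is [-oo] where [h] vanishes), this is expressed
    through its truncations at the levels [k] and [- k], whose weak gradient must
    be [V] where [`|log h| < k] and [0] elsewhere.  In a chart, [V] has components
    [V c x] and the associated differential is the covector
    [V c x *m metric_mx g c x]. *)
Definition is_log_gradient (h : X -> \bar R) (V : chart n X -> X -> 'rV[R]_n) :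
    Prop :=
  is_vector_field g V /\
  forall (k : nat) c (i : 'I_n), atlas g c ->
    weak_partial (chart_image c) i
      (fun y => clamp k (lne (h (chart_inv c y))))
      (fun y => let x := chart_inv c y in
         if `|lne (h x)| < (k%:R)%:E
         then ((V c x *m metric_mx g c x) 0 i)%R else 0%R).

Definition sqnorm_field (V : chart n X -> X -> 'rV[R]_n) (x : X) : R :=
  let c := chart_at g x in sqnorm g c x (V c x).

(** The infimum ranges over the versions [h] of the density and the versions
    [V] of the gradient.  When [rho2] has an a.e. positive density with respect
    to the volume, all of them agree [rho1]-a.e., so the set has at most one
    element; it is empty, and the information infinite, if the log-density is not
    weakly differentiable. *)
Definition fisher_information (rho1 rho2 : probability X R) : \bar R :=
  if `[< rho1 `<< rho2 >] then
    ereal_inf [set I | exists h V,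
      [/\ is_density rho2 rho1 h, is_log_gradient h V &
          I = \int[rho1]_x (sqnorm_field V x)%:E]]
  else +oo.

Definition transport_information (p lam : R) (gam : probability X R) : Prop :=
  forall mu : probability X R, mu `<< gam ->
    (lam ^+ 2)%R%:E * (wasserstein p mu gam) ^+ 2 <= fisher_information mu gam.

End information.

Definition fisher_smooth {d d' : measure_display} {R : realType} {n n' : nat}
    {X : completeMetricMeasurableType d R} {X' : completeMetricMeasurableType d' R}
    (g : riemannian n X) (g' : riemannian n' X') (p L : R) (eps : \bar R)
    (nu : probability X R) (Gam : probability X R -> probability X' R) : Prop :=
  forall mu, wball g p eps nu mu ->
    fisher_information g' (Gam mu) (Gam nu) <=
      (L ^+ 2)%R%:E * (wasserstein p mu nu) ^+ 2.

(** * Optimality maps and coordinate ascent *)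

Section optimality.
Context {d d' : measure_display} {R : realType} {n : nat}.
Context {X : completeMetricMeasurableType d R} {Y : measurableType d'}.
Variables (g : riemannian n X) (F : X -> Y -> R).

Definition mean_potential (nu : probability Y R) (x : X) : \bar R :=
  \int[nu]_y (F x y)%:E.

Definition gibbs_mass (nu : probability Y R) : \bar R :=
  \int[volume g]_x expeR (- mean_potential nu x).

(** The expectation exists in [[-oo, +oo]] for almost every [x] and the
    normalising constant is positive and finite. *)
Definition optimality_defined (nu : probability Y R) : Prop :=
  {ae volume g, forall x, \int[nu]_y (Num.max (F x y) 0)%R%:E < +oo \/
                          \int[nu]_y (Num.max (- F x y) 0)%R%:E < +oo} /\
  0 < gibbs_mass nu < +oo.

(** Outside the measures at which the formula makes sense the value of the map
    is unconstrained. *)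
Definition is_optimality_map (Gam : probability Y R -> probability X R) : Prop :=
  forall nu, optimality_defined nu ->
    is_density (volume g) (Gam nu)
      (fun x => ((fine (gibbs_mass nu))^-1)%R%:E *
                expeR (- mean_potential nu x)).

End optimality.

Section product.
Context {d1 d2 : measure_display} {R : realType} {n1 n2 : nat}.
Context {X1 : completeMetricMeasurableType d1 R}.
Context {X2 : completeMetricMeasurableType d2 R}.

(** [X1 * X2] carries the product Riemannian structure: its volume is the product
    of the volumes and its geodesic distance is the Euclidean combination of the
    distances of the factors. *)
Definition prod_dist (z w : X1 * X2) : R :=
  Num.sqrt ((mdist z.1 w.1) ^+ 2 + (mdist z.2 w.2) ^+ 2)%R.

Definition in_Pp_prod (g1 : riemannian n1 X1) (g2 : riemannian n2 X2) (p : R)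
    (mu : probability (X1 * X2)%type R) : Prop :=
  mu `<< (volume g1 \x volume g2) /\
  exists z0 : X1 * X2, \int[mu]_z ((prod_dist z0 z) `^ p)%R%:E < +oo.

Definition sequential_cavi (T1 : probability X2 R -> probability X1 R)
    (T2 : probability X1 R -> probability X2 R)
    (mu1 : nat -> probability X1 R) (mu2 : nat -> probability X2 R) : Prop :=
  forall k, mu1 k.+1 = T1 (mu2 k) /\ mu2 k.+1 = T2 (mu1 k.+1).

End product.

(* Main.v *)
Require Import Defs.
From mathcomp Require Import all_boot all_order all_algebra.
From mathcomp Require Import all_classical all_reals all_analysis.
From mathcomp Require Import measurable_realfun.

Set Implicit Arguments.
Unset Strict Implicit.
Unset Printing Implicit Defensive.

Import Order.TTheory GRing.Theory Num.Theory.
Import numFieldNormedType.Exports.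

Local Open Scope classical_set_scope.
Local Open Scope ring_scope.
Local Open Scope ereal_scope.

(** Fisher-smoothness of an optimality map bounds the Fisher information of its
    value relative to the fixed point, and the transportation-information
    inequality converts this bound into
      [W_p(opt mu, opt mu_star) <= (L / lambda) * W_p(mu, mu_star)].
    For [k >= 1] both blocks are images of optimality maps, so an iteration
    composes two such estimates.  Membership of the new iterates in the balls
    also requires a finite moment, which the finite distance to the fixed point
    provides. *)

Section optional_measurability.
Context d (T : measurableType d) (R : realType).
Variable mu : {measure set T -> \bar R}.

Import HBNNSimple.

(** Unlike [ge0_le_integral], no measurability is needed: the integral is a
    supremum over the simple functions below the integrand. *)
Lemma ge0_le_integralT (f1 f2 : T -> \bar R) :
  (forall x, 0 <= f1 x) -> (forall x, f1 x <= f2 x) ->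
  \int[mu]_x f1 x <= \int[mu]_x f2 x.
Proof.
move=> f1_ge0 f12.
rewrite !ge0_integralTE//; last by move=> x; exact: le_trans (f12 x).
apply: ereal_sup_le => _ [h/= hf1 <-].
by exists h => // x; exact: le_trans (f12 x).
Qed.

End optional_measurability.

(** The sum is at most twice the larger term, which by symmetry may be taken to be [b]. The constant
    is cruder than the convexity constant [2 ^ (p - 1)], but it serves for every [p >= 0]. *)
Lemma powRD_le (R : realType) (p a b : R) : (0 <= p -> 0 <= a -> 0 <= b ->
  (a + b) `^ p <= 2 `^ p * (a `^ p + b `^ p))%R.
Proof.
move=> p0 a0 b0.
wlog ab : a b a0 b0 / (a <= b)%R.
  move=> H; have [/H->//|/ltW/H] := leP a b.
  by rewrite addrC [(b `^ p + _)%R]addrC => ->.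
apply: (@le_trans _ _ ((2 * b) `^ p)%R).
  apply: ge0_ler_powR => //; rewrite ?nnegrE ?addr_ge0 ?mulr_ge0//.
  by rewrite mulr_natl mulr2n lerD2r.
by rewrite powRM// ler_wpM2l ?powR_ge0// lerDr powR_ge0.
Qed.

Lemma density_dominates d (T : measurableType d) (R : realType)
    (m nu : {measure set T -> \bar R}) (h : T -> \bar R) :
  is_density m nu h -> nu `<< m.
Proof.
move=> [mh h0 nuE]; apply/null_content_dominatesP => A mA mA0.
by rewrite nuE// null_set_integral//; exact: measurable_funTS.
Qed.

Lemma open_mball (R : realType) (M : metricType R) (x : M) (r : R) :
  open [set y | (mdist x y < r)%R].
Proof.
rewrite openE => y /= xy; apply/nbhs_ballP.
exists (r - mdist x y)%R => /=; first by rewrite subr_gt0.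
rewrite ballEmdist => z /=; rewrite ltrBrDl => yz.
exact: le_lt_trans (metric_triangle _ _ _) yz.
Qed.

Section moments.
Context {d : measure_display} {R : realType} {n : nat}.
Context {X : completeMetricMeasurableType d R} (g : riemannian n X).
Implicit Types mu nu : probability X R.

(** The preimage of an open lower ray is an open ball, and the sigma-algebra of a Riemannian
    manifold is the Borel one. *)
Lemma measurable_mdist (x : X) : measurable_fun [set: X] (mdist x : X -> R).
Proof.
apply: (measurability _ (RGenInftyO.measurableE R)) => _ [_ [r ->] <-].
case: g => _ _ _ borel _ _ _ _.
rewrite setTI borel; apply: sub_sigma_algebra.
rewrite (_ : _ @^-1` _ = [set y | (mdist x y < r)%R]); first exact: open_mball.
by apply/seteqP; split => y /=; rewrite in_itv.
Qed.

Lemma wasserstein_lty_coupling (p : R) mu nu : (0 < p)%R ->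
  wasserstein p mu nu < +oo ->
  exists2 gam, coupling mu nu gam &
    \int[gam]_z ((mdist z.1 z.2) `^ p)%R%:E < +oo.
Proof.
move=> p0 /lty_poweRy => /(_ (lt0r_neq0 _)); rewrite invr_gt0 => /(_ p0).
by move=> /ereal_inf_lt[_ [gam cgam <-] ?]; exists gam.
Qed.

(** Change of variables: [mu] is the pushforward of [gam] under the first projection. *)
Lemma coupling_integral1 mu nu gam (h : X -> \bar R) : coupling mu nu gam ->
  measurable_fun setT h -> (forall x, 0 <= h x) ->
  \int[mu]_x h x = \int[gam]_z h z.1.
Proof.
move=> cgam mh h0; transitivity (\int[pushforward gam fst]_x h x); last first.
  by rewrite ge0_integral_pushforward.
apply: eq_measure_integral => A mA _.
apply/esym/(eq_trans _ (cgam A mA).1); congr (gam _).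
by apply/seteqP; split => // z [].
Qed.

Lemma coupling_integral2 mu nu gam (h : X -> \bar R) : coupling mu nu gam ->
  measurable_fun setT h -> (forall x, 0 <= h x) ->
  \int[nu]_x h x = \int[gam]_z h z.2.
Proof.
move=> cgam mh h0; transitivity (\int[pushforward gam snd]_x h x); last first.
  by rewrite ge0_integral_pushforward.
apply: eq_measure_integral => A mA _.
apply/esym/(eq_trans _ (cgam A mA).2); congr (gam _).
by apply/seteqP; split => // z [].
Qed.

(** Along a coupling of finite cost, the triangle inequality and [powRD_le] bound [d(x0, x) ^ p] by
    [2 ^ p * (d(x0, y) ^ p + d(x, y) ^ p)]. Integrating transfers the finite moment from [nu] to
    [mu], with the same base point. *)
Lemma in_Pp_wasserstein_lty (p : R) mu nu : (0 < p)%R -> mu `<< volume g ->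
  in_Pp g p nu -> wasserstein p mu nu < +oo -> in_Pp g p mu.
Proof.
move=> p0 mu_vol [_ [x0 nu_lty]].
move=> /(wasserstein_lty_coupling p0)[gam cgam gam_lty].
split=> //; exists x0.
pose h x := ((mdist x0 x : R) `^ p)%R.
pose c := (2 `^ p : R)%R.
have c0 : (0 < c)%R by exact: powR_gt0.
have mh : measurable_fun setT h.
  exact: measurableT_comp (measurable_powR p) (measurable_mdist x0).
have mh1 : measurable_fun setT (fun z : X * X => h z.1).
  exact: measurableT_comp mh measurable_fst.
have mh2 : measurable_fun setT (fun z : X * X => h z.2).
  exact: measurableT_comp mh measurable_snd.
(* Replacing the cost [d(x, y) ^ p] by this measurable lower bound avoids
   proving that the distance is measurable for the product sigma-algebra. *)
pose G (z : X * X) := Num.max (c^-1 * h z.1 - h z.2)%R 0%R.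
have G0 z : (0 <= G z)%R by rewrite le_max lexx orbT.
have mG : measurable_fun setT G.
  apply: measurable_maxr => //; apply: measurable_funB => //.
  exact: measurable_funM.
(* [G] is the least nonnegative function for which this bound holds. The triangle inequality then
   places it below the cost. *)
have hG z : (h z.1 <= c * (h z.2 + G z))%R.
  by rewrite -ler_pdivrMl// -lerBlDl le_max lexx.
have Gd z : (G z <= (mdist z.1 z.2) `^ p)%R.
  rewrite ge_max powR_ge0 andbT lerBlDl ler_pdivrMl//.
  apply: le_trans (powRD_le (ltW p0) (mdist_ge0 _ _) (mdist_ge0 _ _)).
  apply: ge0_ler_powR; rewrite ?nnegrE ?addr_ge0 ?mdist_ge0//; first exact: ltW.
  by rewrite [mdist z.1 _]metric_sym; exact: metric_triangle.
rewrite (coupling_integral1 cgam (h := fun x => (h x)%:E)); last 2 first.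
- exact/measurable_EFinP.
- by move=> x; rewrite lee_fin powR_ge0.
apply: (@le_lt_trans _ _ (\int[gam]_z (c%:E * ((h z.2)%:E + (G z)%:E)))).
  apply: ge0_le_integralT => z; first by rewrite lee_fin powR_ge0.
  by rewrite -EFinD -EFinM lee_fin.
have h0 x : 0 <= (h x)%:E by rewrite lee_fin powR_ge0.
have GE0 z : 0 <= (G z)%:E by rewrite lee_fin.
have mhE2 : measurable_fun setT (fun z : X * X => (h z.2)%:E).
  exact/measurable_EFinP.
have mGE : measurable_fun setT (fun z => (G z)%:E) by exact/measurable_EFinP.
rewrite ge0_integralZl_EFin//; last 3 first.
- by move=> z _; rewrite adde_ge0.
- exact: emeasurable_funD.
- exact: ltW.
rewrite ge0_integralD//.
rewrite lte_mul_pinfty// ?lee_fin ?(ltW c0)// lte_add_pinfty//.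
  by rewrite -(coupling_integral2 cgam (h := fun x => (h x)%:E))//;
    exact/measurable_EFinP.
by apply: le_lt_trans gam_lty; apply: ge0_le_integralT => z; rewrite lee_fin.
Qed.

End moments.

(** If [Gam mu] is not dominated by [Gam nu], its Fisher information is
    infinite, which smoothness excludes because balls have finite radius. *)
Lemma fisher_smooth_wasserstein {d d' : measure_display} {R : realType}
    {n n' : nat} {X : completeMetricMeasurableType d R}
    {X' : completeMetricMeasurableType d' R}
    (g : riemannian n X) (g' : riemannian n' X') (p L lam : R) (eps : \bar R)
    (nu mu : probability X R) (Gam : probability X R -> probability X' R) :
  (0 <= L)%R -> (0 < lam)%R ->
  fisher_smooth g g' p L eps nu Gam -> transport_information g' p lam (Gam nu) ->
  wball g p eps nu mu ->
  wasserstein p (Gam mu) (Gam nu) <= (L / lam)%R%:E * wasserstein p mu nu.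
Proof.
move=> L0 lam0 smooth ti mu_ball.
(* The inequality defining the ball is strict, so the distance is finite even for the radius
   [+oo]. *)
have W_lty : wasserstein p mu nu < +oo by exact: lt_le_trans mu_ball.2 (leey _).
have W0 : 0 <= wasserstein p mu nu by exact: poweR_ge0.
have W'0 : 0 <= wasserstein p (Gam mu) (Gam nu) by exact: poweR_ge0.
have I_le := smooth _ mu_ball.
move: W_lty W0 I_le; case: (wasserstein p mu nu) => // w _ w0 I_le.
have dom : Gam mu `<< Gam nu.
  apply: contrapT => ndom; move: I_le.
  by rewrite /fisher_information asboolF// -EFin_expe -EFinM leye_eq.
have := le_trans (ti _ dom) I_le.
move: W'0; case: (wasserstein p (Gam mu) (Gam nu)) => [w'||] // w'0.
  (* Both distances are finite here: take square roots in [(lam * w') ^ 2 <= (L * w) ^ 2]. *)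
  rewrite -!EFin_expe -!EFinM !lee_fin -!exprMn => le_sq.
  rewrite mulrAC ler_pdivlMr// mulrC -ler_sqr// nnegrE mulr_ge0//.
  exact: ltW.
(* An infinite distance would make the left side of the information bound [+oo], since [lam > 0],
   while its right side is finite. *)
by rewrite expe2 mulyy gt0_muley ?lte_fin ?exprn_gt0//.
Qed.

Theorem theorem1 (R : realType) (d1 d2 : measure_display) (n1 n2 : nat)
    (X1 : completeMetricMeasurableType d1 R)
    (X2 : completeMetricMeasurableType d2 R)
    (g1 : riemannian n1 X1) (g2 : riemannian n2 X2)
    (p : R) (hp : (1 <= p)%R)
    (f : X1 * X2 -> R) (pi : probability (X1 * X2)%type R)
    (pi_Pp : in_Pp_prod g1 g2 p pi)
    (pi_density : is_density (volume g1 \x volume g2) pi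
                    (fun z => (expR (- f z))%:E))
    (opt1 : probability X2 R -> probability X1 R)
    (opt2 : probability X1 R -> probability X2 R)
    (opt1_map : is_optimality_map g1 (fun x1 x2 => f (x1, x2)) opt1)
    (opt2_map : is_optimality_map g2 (fun x2 x1 => f (x1, x2)) opt2)
    (mustar1 : probability X1 R) (mustar2 : probability X2 R)
    (mustar1_Pp : in_Pp g1 p mustar1) (mustar2_Pp : in_Pp g2 p mustar2)
    (mustar2_defined :
       optimality_defined g1 (fun x1 x2 => f (x1, x2)) mustar2)
    (mustar1_defined :
       optimality_defined g2 (fun x2 x1 => f (x1, x2)) mustar1)
    (fixed1 : mustar1 = opt1 mustar2) (fixed2 : mustar2 = opt2 mustar1)
    (L12 L21 lam1 lam2 : R) (eps1 eps2 : \bar R)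
    (L12_ge0 : (0 <= L12)%R) (L21_ge0 : (0 <= L21)%R)
    (lam1_gt0 : (0 < lam1)%R) (lam2_gt0 : (0 < lam2)%R)
    (eps1_gt0 : 0 < eps1) (eps2_gt0 : 0 < eps2)
    (smooth1 : fisher_smooth g2 g1 p L12 eps2 mustar2 opt1)
    (smooth2 : fisher_smooth g1 g2 p L21 eps1 mustar1 opt2)
    (ti1 : transport_information g1 p lam1 mustar1)
    (ti2 : transport_information g2 p lam2 mustar2)
    (contraction : (L12 * L21 < lam1 * lam2)%R)
    (mu1 : nat -> probability X1 R) (mu2 : nat -> probability X2 R)
    (cavi : sequential_cavi opt1 opt2 mu1 mu2)
    (mu2_defined : forall k,
       optimality_defined g1 (fun x1 x2 => f (x1, x2)) (mu2 k))
    (mu1_defined : forall k,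
       optimality_defined g2 (fun x2 x1 => f (x1, x2)) (mu1 k.+1))
    (k : nat) (k_ge1 : (1 <= k)%N)
    (mu1_ball : wball g1 p eps1 mustar1 (mu1 k))
    (mu2_ball : wball g2 p eps2 mustar2 (mu2 k)) :
  let rho := (L12 * L21 / (lam1 * lam2))%R in
  [/\ wasserstein p (mu1 k.+1) mustar1 <= rho%:E * wasserstein p (mu1 k) mustar1
      /\ wasserstein p (mu2 k.+1) mustar2 <= rho%:E * wasserstein p (mu2 k) mustar2,
      wball g1 p eps1 mustar1 (mu1 k.+1) /\ wball g2 p eps2 mustar2 (mu2 k.+1),
      forall j, (k <= j)%N ->
        wasserstein p (mu1 j.+1) mustar1 <= rho%:E * wasserstein p (mu1 j) mustar1
        /\ wasserstein p (mu2 j.+1) mustar2 <= rho%:E * wasserstein p (mu2 j) mustar2 &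
      forall m,
        wasserstein p (mu1 (k + m)%N) mustar1
          <= (rho ^+ m)%R%:E * wasserstein p (mu1 k) mustar1
        /\ wasserstein p (mu2 (k + m)%N) mustar2
          <= (rho ^+ m)%R%:E * wasserstein p (mu2 k) mustar2].
Proof.
move=> rho.
have p0 : (0 < p)%R by exact: lt_le_trans hp.
have lam12_gt0 : (0 < lam1 * lam2)%R by exact: mulr_gt0.
have rho_ge0 : (0 <= rho)%R by rewrite divr_ge0 ?mulr_ge0// ltW.
have rho_lt1 : (rho < 1)%R by rewrite ltr_pdivrMr// mul1r.
have rhoE : rho = (L12 / lam1 * (L21 / lam2))%R by rewrite mulf_div.
have rhoE' : rho = (L21 / lam2 * (L12 / lam1))%R by rewrite mulrC.
have bound1 j : wball g2 p eps2 mustar2 (mu2 j) ->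
    wasserstein p (mu1 j.+1) mustar1
      <= (L12 / lam1)%R%:E * wasserstein p (mu2 j) mustar2.
  move=> ball2; rewrite (cavi j).1 [in leLHS]fixed1.
  by apply: fisher_smooth_wasserstein smooth1 _ ball2 => //; rewrite -fixed1.
(* Both blocks carry the same index, since the second update uses the fresh first block. The index 0
   is excluded because [mu2 0] is the arbitrary initial measure, not a value of [opt2]. *)
have bound2 j : (1 <= j)%N -> wball g1 p eps1 mustar1 (mu1 j) ->
    wasserstein p (mu2 j) mustar2
      <= (L21 / lam2)%R%:E * wasserstein p (mu1 j) mustar1.
  case: j => // j _ ball1; rewrite (cavi j).2 [in leLHS]fixed2.
  by apply: fisher_smooth_wasserstein smooth2 _ ball1 => //; rewrite -fixed2.
have dom1 j : mu1 j.+1 `<< volume g1.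
  rewrite (cavi j).1; apply: density_dominates.
  exact: opt1_map (mu2_defined j).
have dom2 j : mu2 j.+1 `<< volume g2.
  rewrite (cavi j).2; apply: density_dominates.
  exact: opt2_map (mu1_defined j).
have compose (a b : R) (x y z : \bar R) : (0 <= a)%R ->
    x <= a%:E * y -> y <= b%:E * z -> x <= (a * b)%R%:E * z.
  move=> a0 xy yz; apply: le_trans xy _.
  by rewrite EFinM -muleA lee_wpmul2l// lee_fin.
(* Strictness comes from [y < e], so the case [y = 0] is covered. *)
have shrink (x y e : \bar R) : 0 <= y -> x <= rho%:E * y -> y < e -> x < e.
  move=> y0 xy ye; apply: le_lt_trans ye; apply: le_trans xy _.
  by rewrite -[leRHS]mul1e lee_wpmul2r// lee_fin ltW.
have step j : (1 <= j)%N ->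
    wball g1 p eps1 mustar1 (mu1 j) -> wball g2 p eps2 mustar2 (mu2 j) ->
    (wasserstein p (mu1 j.+1) mustar1 <= rho%:E * wasserstein p (mu1 j) mustar1
     /\ wasserstein p (mu2 j.+1) mustar2
          <= rho%:E * wasserstein p (mu2 j) mustar2) /\
    (wball g1 p eps1 mustar1 (mu1 j.+1) /\ wball g2 p eps2 mustar2 (mu2 j.+1)).
  move=> j1 ball1 ball2.
  have W1 : wasserstein p (mu1 j.+1) mustar1
      <= rho%:E * wasserstein p (mu1 j) mustar1.
    rewrite rhoE; apply: compose (bound1 _ ball2) (bound2 _ j1 ball1).
    by rewrite divr_ge0// ltW.
  have W1_lt := shrink _ _ _ (poweR_ge0 _ _) W1 ball1.2.
  (* The new first block must be placed in its ball before smoothness of [opt2] can be applied to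
     it. *)
  have ball1' : wball g1 p eps1 mustar1 (mu1 j.+1).
    split=> //; apply: (in_Pp_wasserstein_lty p0 (dom1 j) mustar1_Pp).
    exact: lt_le_trans W1_lt (leey _).
  have W2 : wasserstein p (mu2 j.+1) mustar2
      <= rho%:E * wasserstein p (mu2 j) mustar2.
    rewrite rhoE'; apply: compose (bound2 _ _ ball1') (bound1 _ ball2) => //.
    by rewrite divr_ge0// ltW.
  have W2_lt := shrink _ _ _ (poweR_ge0 _ _) W2 ball2.2.
  split; split=> //; split=> //.
  apply: (in_Pp_wasserstein_lty p0 (dom2 j) mustar2_Pp).
  exact: lt_le_trans W2_lt (leey _).
(* The pair of balls is invariant under an iteration, so the one-step bounds propagate from [k] to
   all later indices. *)
have balls m : wball g1 p eps1 mustar1 (mu1 (k + m)%N) /\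
               wball g2 p eps2 mustar2 (mu2 (k + m)%N).
  elim: m => [|m [ball1 ball2]]; first by rewrite addn0.
  by rewrite addnS; apply: (step _ _ ball1 ball2).2; rewrite ltn_addr.
have rate m : wasserstein p (mu1 (k + m).+1) mustar1
      <= rho%:E * wasserstein p (mu1 (k + m)%N) mustar1 /\
    wasserstein p (mu2 (k + m).+1) mustar2
      <= rho%:E * wasserstein p (mu2 (k + m)%N) mustar2.
  by have [ball1 ball2] := balls m; apply: (step _ _ ball1 ball2).1;
    rewrite ltn_addr.
split.
- exact: (step _ k_ge1 mu1_ball mu2_ball).1.
- exact: (step _ k_ge1 mu1_ball mu2_ball).2.
- by move=> j /subnKC <-.
- elim=> [|m [IH1 IH2]]; first by rewrite addn0 expr0 !mul1e.
  have [W1 W2] := rate m.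
  by rewrite addnS exprS; split; [exact: compose W1 IH1|exact: compose W2 IH2].
Qed.
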